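(* Let $\mu\in\mathrm{Sz}^c$ and let $f:\mathbb{N}\to\mathbb{N}$ be any $\beta$-approximating function for $\mu$. Let $\mathbf{k}=(k_j)_{j\in\mathbb{N}}\in\mathbb{N}^{\mathbb{N}}$ be strictly increasing and let $\bm{\ell}=(\ell_j)_{j\in\mathbb{N}}\in\mathbb{N}_0^{\mathbb{N}}$ be such that $$\lim_{j\to\infty}\big(\ell_j-f(k_j)\big)=\infty.$$ Then $E(\Lambda(\mathbf{k},\bm{\ell}))$ is dense in $L^2(\mathbb{T},\mu)$.
   Context: Conventions: $\mathbb{N}=\{1,2,3,\dots\}$, $\mathbb{N}_0=\mathbb{N}\cup\{0\}$, $\mathbb{T}$ is the complex unit circle (identified with $[0,2\pi)$), $\mathrm{d}m=\frac{\mathrm{d}\theta}{2\pi}$ is normalized Lebesgue measure on $\mathbb{T}$, and $\llbracket n,m\rrbracket:=[n,m]\cap\mathbb{Z}$ for integers $n\le m$. $\mathcal{P}$ is the set of all probability measures on $\mathbb{T}$ with infinite support. Each $\mu\in\mathcal{P}$ has a Lebesgue decomposition $\mathrm{d}\mu=w\,\mathrm{d}m+\mathrm{d}\mu_s$ with $\mu_s$ singular with respect to $m$. $\mathrm{Sz}$ is the set of all $\mu\in\mathcal{P}$ with $\int_0^{2\pi}\log(w(\theta))\,\mathrm{d}\theta>-\infty$, and $\mathrm{Sz}^c:=\mathcal{P}\setminus\mathrm{Sz}$ (i.e. the integral equals $-\infty$). $\mathbb{P}_{\le n}$ is the space of complex polynomials of degree at most $n$. For $\mu\in\mathcal{P}$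 and $k,n\in\mathbb{N}_0$, $\beta_\mu(k,n):=\min_{\pi\in\mathbb{P}_{\le n}}\|z^{-k}-\pi(z)\|_{L^2(\mathbb{T},\mu)}$. A strictly increasing function $f:\mathbb{N}\to\mathbb{N}$ is called $\beta$-approximating for $\mu$ if $\lim_{k\to\infty}\beta_\mu(k,f(k))=0$. For $\Lambda\subseteq\mathbb{N}_0$, $E(\Lambda)$ is the complex linear span of the functions $z\mapsto z^\lambda$ on $\mathbb{T}$, $\lambda\in\Lambda$. For strictly increasing $\mathbf{k}\in\mathbb{N}^{\mathbb{N}}$ and $\bm{\ell}\in\mathbb{N}_0^{\mathbb{N}}$, $\Lambda(\mathbf{k},\bm{\ell}):=\bigcup_{j\in\mathbb{N}}\llbracket k_j,k_j+\ell_j\rrbracket$ (the intervals need not be disjoint). *)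

(* Defs.v *)
From HB Require Import structures.
From mathcomp Require Import all_boot all_order all_algebra.
From mathcomp Require Import complex.
From mathcomp Require Import all_classical all_reals all_analysis.

Set Implicit Arguments.
Unset Strict Implicit.
Unset Printing Implicit Defensive.

Import Order.TTheory GRing.Theory Num.Theory.
Import numFieldNormedType.Exports.

Local Open Scope classical_set_scope.
Local Open Scope ring_scope.

Section circle.
Context {R : realType}.

Definition cmod (z : R[i]) : R := complex.Re `|z|.

Definition unit_circle := {z : R[i] | `|z| == 1}.

Lemma unit_circle1 : `|1 : R[i]| == 1. Proof. by rewrite normr1. Qed.

HB.instance Definition _ := Choice.on unit_circle.
HB.instance Definition _ :=
  isPointed.Build unit_circle (exist _ (1 : R[i]) unit_circle1).

Definition reim (z : unit_circle) : R * R :=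
  (complex.Re (val z), complex.Im (val z)).

(* The trace on the circle of the Borel sigma-algebra of the plane. *)
Definition circle := g_sigma_algebra_preimageType reim.

HB.instance Definition _ := Measurable.on circle.

Definition circle_val (z : circle) : R[i] := val (z : unit_circle).
Coercion circle_val : circle >-> complex.

Lemma expi_subproof (t : R) : `|(cos t +i* sin t)%C| == 1.
Proof. by rewrite normc_def cos2Dsin2 sqrtr1. Qed.

Definition expi (t : measurableTypeR R) : circle :=
  exist _ (cos t +i* sin t)%C (expi_subproof t).

Lemma measurable_expi : measurable_fun [set: measurableTypeR R] expi.
Proof.
move=> _ _ [B mB <-]; rewrite !setTI.
have mcs : measurable_fun [set: measurableTypeR R]
    (fun t : measurableTypeR R => (cos t, sin t) : R * R).
  apply: measurable_fun_pair.
    apply: measurable_realfun.continuous_measurable_fun.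
    exact: continuous_cos.
  apply: measurable_realfun.continuous_measurable_fun.
  exact: continuous_sin.
by have := mcs measurableT B mB; rewrite setTI.
Qed.

HB.instance Definition _ :=
  isMeasurableFun.Build _ _ (measurableTypeR R) circle expi measurable_expi.

Lemma lt0_2pi : (0 : R) < 2 * pi.
Proof. by rewrite mulr_gt0 ?pi_gt0. Qed.

(* dm = dtheta / 2 pi. *)
Definition circle_leb : set circle -> \bar R :=
  distribution (uniform_prob lt0_2pi) expi.

HB.instance Definition _ := Measure.on circle_leb.

End circle.
Arguments circle R : clear implicits.

Section szego_class.
Context {R : realType}.
Implicit Type mu : probability (circle R) R.
Local Open Scope ereal_scope.

Definition msupport mu : set (circle R) :=
  [set z | forall e : R, (0 < e)%R ->
           0 < mu [set y : circle R | (cmod ((y : R[i]) - (z : R[i])) < e)%R]].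

Definition inf_support mu : Prop := infinite_set (msupport mu).

Definition mutually_singular (mu nu : {measure set (circle R) -> \bar R}) :=
  exists N, [/\ measurable N, mu (~` N) = 0 & nu N = 0].

(* dmu = w dm + dmus *)
Definition lebesgue_decomposition mu (w : circle R -> R)
    (mus : {measure set (circle R) -> \bar R}) : Prop :=
  [/\ measurable_fun [set: circle R] w,
      (forall z, (0 <= w z)%R),
      mutually_singular mus circle_leb &
      forall A, measurable A ->
        mu A = \int[circle_leb]_(z in A) (w z)%:E + mus A].

(* [lne] is the extended logarithm, with [lne 0 = -oo]. The positive part of
   [log w] is integrable since [w] is, so the integral is never of the form
   oo - oo. *)
Definition Sz mu : Prop :=
  inf_support mu /\
  exists (w : circle R -> R) (mus : {measure set (circle R) -> \bar R}),
    lebesgue_decomposition mu w mus /\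
    -oo < \int[lebesgue_measure]_(t in `[0%R, (2 * pi)%R]) lne (w (expi t))%:E.

Definition Szc mu : Prop := inf_support mu /\ ~ Sz mu.

End szego_class.

Section L2.
Context {R : realType}.
Variable mu : probability (circle R) R.
Implicit Types g h : circle R -> R[i].
Local Open Scope ereal_scope.

Definition norm2 g : \bar R := 'N[mu]_2%:E[EFin \o cmod \o g].

(* The square-integrable functions; [norm2] is only a seminorm on them, and
   L^2 is the quotient by its kernel. *)
Definition memL2 : set (circle R -> R[i]) :=
  [set g | [/\ measurable_fun [set: circle R] (fun z => complex.Re (g z)),
               measurable_fun [set: circle R] (fun z => complex.Im (g z)) &
               norm2 g < +oo]].

Definition dense_in_L2 (S : set (circle R -> R[i])) : Prop :=
  S `<=` memL2 /\
  forall g, memL2 g -> forall e : R, (0 < e)%R ->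
    exists2 h, S h & norm2 (fun z => g z - h z)%R < e%:E.

(* The infimum is attained, [{poly R[i]}] of bounded size being
   finite-dimensional. *)
Definition beta (k n : nat) : \bar R :=
  ereal_inf [set norm2 (fun z : circle R => (z : R[i]) ^- k - p.[z : R[i]])%R
            | p in [set p : {poly R[i]} | (size p <= n.+1)%N]].

End L2.

(* A strictly increasing function from {1, 2, ...} to itself; the value at 0 is
   irrelevant. *)
Definition increasing_posnat (f : nat -> nat) : Prop :=
  (forall k, (0 < k)%N -> (0 < f k)%N) /\
  (forall j k, (0 < j)%N -> (j < k)%N -> (f j < f k)%N).

Definition beta_approximating (R : realType) (mu : probability (circle R) R)
    (f : nat -> nat) : Prop :=
  increasing_posnat f /\ beta mu k (f k) @[k --> \oo] --> 0%E.

Definition E {R : realType} (Lam : set nat) : set (circle R -> R[i]) :=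
  [set h | exists (s : seq nat) (c : nat -> R[i]),
     (forall n, n \in s -> Lam n) /\
     h = (fun z : circle R => \sum_(n <- s) c n * (z : R[i]) ^+ n)].

Definition Lambda (k l : nat -> nat) : set nat :=
  [set n | exists j, [/\ (0 < j)%N, (k j <= n)%N & (n <= k j + l j)%N]].

(* Main.v *)
Require Import Defs.
From mathcomp Require Import all_boot all_order all_algebra.
From mathcomp Require Import complex.
From mathcomp Require Import all_classical all_reals all_analysis.
From mathcomp Require Import measurable_realfun.
From mathcomp Require Import ring lra.

Set Implicit Arguments.
Unset Strict Implicit.
Unset Printing Implicit Defensive.

Import Order.TTheory GRing.Theory Num.Theory.
Import numFieldNormedType.Exports.

Local Open Scope classical_set_scope.
Local Open Scope ring_scope.

(** Fix mu and let W be the closure of the polynomials in L^2(mu).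

    If pi approximates z^-k in L^2(mu), then z^(k-1) pi approximates z^-1
    equally well because |z| = 1 on the circle; as beta(k, f k) tends to 0, z^-1
    lies in W, and W is stable under multiplication by z^-1, hence by Re z and
    Im z. The polynomials (1 - y^(2n))^(n 4^n) converge boundedly on [0, 1] to the
    indicator of y < 1/2, so by dominated convergence W is stable under
    multiplication by the indicators of the half-planes Re z < a and Im z < a.
    The sets whose indicator preserves W form a sigma-algebra, hence they are all
    the Borel sets; therefore W contains the simple functions and is all of
    L^2(mu). Szego's theorem is thereby avoided: the existence of a
    beta-approximating function already makes the polynomials dense.

    Finally a polynomial p is approximated by z^(k_j) pi_j p, where pi_j
    approximates z^(-k_j) with degree at most f(k_j); the exponents occurring lie
    in [k_j, k_j + f(k_j) + deg p], which is contained in [k_j, k_j + l_j] for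
    large j. *)

Section sqmod.
Context {R : realType}.
Implicit Types z w : R[i].

Definition sqmod z : R := complex.Re z ^+ 2 + complex.Im z ^+ 2.

Lemma sqmod_ge0 z : 0 <= sqmod z.
Proof. by rewrite addr_ge0 ?sqr_ge0. Qed.

Lemma cmodE z : cmod z = Num.sqrt (sqmod z).
Proof. by rewrite /cmod normc_def. Qed.

Lemma cmod_ge0 z : 0 <= cmod z.
Proof. by rewrite cmodE sqrtr_ge0. Qed.

Lemma sqr_cmod z : cmod z ^+ 2 = sqmod z.
Proof. by rewrite cmodE sqr_sqrtr ?sqmod_ge0. Qed.

Lemma sqmodM z w : sqmod (z * w) = sqmod z * sqmod w.
Proof. by case: z w => a b [c d]; rewrite /sqmod /=; ring. Qed.

Lemma sqmodD_le z w : sqmod (z + w) <= 2 * (sqmod z + sqmod w).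
Proof.
case: z w => a b [c d]; rewrite /sqmod /=.
have := sqr_ge0 (a - c); have := sqr_ge0 (b - d); nra.
Qed.

Lemma sqmod_real (a : R) : sqmod a%:C%C = a ^+ 2.
Proof. by rewrite /sqmod /= expr0n addr0. Qed.

Lemma sqmod_circle (z : circle R) : sqmod (z : R[i]) = 1.
Proof.
have /eqP := valP (z : unit_circle).
rewrite -/(circle_val z) normc_def => -[] sq1.
by rewrite -[LHS]sqr_sqrtr ?sqmod_ge0// sq1 expr1n.
Qed.

Lemma circle_neq0 (z : circle R) : (z : R[i]) != 0.
Proof.
apply/eqP => z0; have := sqmod_circle z.
by rewrite z0 /sqmod /= expr0n addr0 => /eqP; rewrite eq_sym oner_eq0.
Qed.

Lemma sqmod_circleX (z : circle R) n : sqmod ((z : R[i]) ^+ n) = 1.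
Proof.
elim: n => [|n IHn]; first by rewrite expr0 /sqmod /= expr1n expr0n addr0.
by rewrite exprS sqmodM IHn sqmod_circle mulr1.
Qed.

Lemma circleV (z : circle R) :
  (z : R[i])^-1 = (complex.Re z -i* complex.Im z)%C.
Proof.
have := sqmod_circle z; rewrite /sqmod; case: (circle_val z) => a b /= sq1.
have z0 : (a +i* b)%C != 0.
  by apply/eqP => -[a0 b0]; move: sq1; rewrite a0 b0; lra.
apply: (mulfI z0); rewrite mulfV//; apply/eqP.
by rewrite eq_complex /=; apply/andP; split; apply/eqP; lra.
Qed.

Lemma sqmod_horner_bounded (p : {poly R[i]}) :
  exists C : R, forall z : circle R, sqmod p.[z : R[i]] <= C.
Proof.
elim/poly_ind: p => [|p c [C pC]].
  by exists (sqmod 0) => z; rewrite horner0.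
exists (2 * (C + sqmod c)) => z; rewrite hornerMXaddC.
apply: le_trans (sqmodD_le _ _) _.
by rewrite sqmodM sqmod_circle mulr1 ler_wpM2l// lerD2r.
Qed.

End sqmod.

Section complex_measurability.
Context {R : realType}.
Implicit Types g h : circle R -> R[i].

Definition cmeasurable g :=
  measurable_fun [set: circle R] (fun z => complex.Re (g z)) /\
  measurable_fun [set: circle R] (fun z => complex.Im (g z)).

Lemma measurable_reim : measurable_fun [set: circle R] (@reim R : circle R -> R * R).
Proof. by move=> _ B mB; rewrite setTI; exists B => //; rewrite setTI. Qed.

Lemma cmeasurable_circle_val : cmeasurable (@circle_val R).
Proof.
split.
  exact: (measurableT_comp measurable_fst measurable_reim).
exact: (measurableT_comp measurable_snd measurable_reim).
Qed.

Lemma cmeasurable_cst (c : R[i]) : cmeasurable (fun=> c).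
Proof. by split; exact: measurable_cst. Qed.

Lemma cmeasurableD g h : cmeasurable g -> cmeasurable h ->
  cmeasurable (fun z => g z + h z).
Proof.
move=> [mg1 mg2] [mh1 mh2]; split.
  rewrite (_ : (fun _ => _) = (fun z => complex.Re (g z) + complex.Re (h z))).
    exact: measurable_funD.
  by apply/funext => z; case: (g z) (h z) => a b [].
rewrite (_ : (fun _ => _) = (fun z => complex.Im (g z) + complex.Im (h z))).
  exact: measurable_funD.
by apply/funext => z; case: (g z) (h z) => a b [].
Qed.

Lemma cmeasurableM g h : cmeasurable g -> cmeasurable h ->
  cmeasurable (fun z => g z * h z).
Proof.
move=> [mg1 mg2] [mh1 mh2]; split.
  rewrite (_ : (fun _ => _) = (fun z => complex.Re (g z) * complex.Re (h z)
      - complex.Im (g z) * complex.Im (h z))).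
    by apply: measurable_funB; exact: measurable_funM.
  by apply/funext => z; case: (g z) (h z) => a b [].
rewrite (_ : (fun _ => _) = (fun z => complex.Re (g z) * complex.Im (h z)
    + complex.Im (g z) * complex.Re (h z))).
  by apply: measurable_funD; exact: measurable_funM.
by apply/funext => z; case: (g z) (h z) => a b [].
Qed.

Lemma cmeasurableB g h : cmeasurable g -> cmeasurable h ->
  cmeasurable (fun z => g z - h z).
Proof.
move=> mg mh; rewrite (_ : (fun _ => _) = (fun z => g z + (-1) * h z)).
  by apply: cmeasurableD => //; apply: cmeasurableM => //; exact: cmeasurable_cst.
by apply/funext => z; rewrite mulN1r.
Qed.

Lemma cmeasurable_real (u : circle R -> R) : measurable_fun setT u ->
  cmeasurable (fun z => (u z)%:C%C).
Proof. by move=> mu; split => //; exact: measurable_cst. Qed.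

Lemma cmeasurableX g n : cmeasurable g -> cmeasurable (fun z => g z ^+ n).
Proof.
move=> mg; elim: n => [|n IHn].
  by under eq_fun do rewrite expr0; exact: cmeasurable_cst.
by under eq_fun do rewrite exprS; exact: cmeasurableM.
Qed.

Lemma cmeasurable_sum I (s : seq I) (F : I -> circle R -> R[i]) :
  (forall i, cmeasurable (F i)) -> cmeasurable (fun z => \sum_(i <- s) F i z).
Proof.
move=> mF; elim: s => [|i s IHs].
  by under eq_fun do rewrite big_nil; exact: cmeasurable_cst.
by under eq_fun do rewrite big_cons; exact: cmeasurableD.
Qed.

Lemma cmeasurableV : cmeasurable (fun z : circle R => (z : R[i])^-1).
Proof.
have [m1 m2] := cmeasurable_circle_val.
split; under eq_fun do rewrite circleV; first exact: m1.
exact: measurable_funN m2.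
Qed.

Lemma cmeasurable_horner (p : {poly R[i]}) :
  cmeasurable (fun z : circle R => p.[z : R[i]]).
Proof.
under eq_fun do rewrite horner_coef.
apply: cmeasurable_sum => i.
apply: cmeasurableM; first exact: cmeasurable_cst.
exact/cmeasurableX/cmeasurable_circle_val.
Qed.

Lemma measurable_sqmod g : cmeasurable g ->
  measurable_fun setT (fun z => (sqmod (g z))%:E).
Proof.
move=> [m1 m2]; apply/measurable_EFinP.
by apply: measurable_funD; exact: measurable_funX.
Qed.

End complex_measurability.

Section L2_closure.
Context {R : realType}.
Variable mu : probability (circle R) R.
Implicit Types g h : circle R -> R[i].
Local Open Scope ereal_scope.

Definition energy g : \bar R := \int[mu]_z (sqmod (g z))%:E.

Lemma energy_ge0 g : 0 <= energy g.
Proof. by apply: integral_ge0 => z _; rewrite lee_fin sqmod_ge0. Qed.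

Lemma norm2E g : norm2 mu g = energy g `^ 2^-1.
Proof.
rewrite /norm2 unlock /energy; congr (_ `^ _).
apply: eq_integral => z _ /=; rewrite ger0_norm ?cmod_ge0//.
by rewrite -sqr_cmod powR_mulrn ?cmod_ge0.
Qed.

Lemma norm2_lt g (e : R) : (0 < e)%R ->
  (norm2 mu g < e%:E) = (energy g < (e ^+ 2)%:E).
Proof.
move=> e0; rewrite norm2E poweR12_sqrt ?energy_ge0//.
have := energy_ge0 g; case: (energy g) => [r r0|_|//].
  by rewrite /= !lte_fin -{1}(gtr0_norm e0) -sqrtr_sqr ltr_sqrt// exprn_gt0.
by rewrite /= !ltNge !leey.
Qed.

Lemma norm2_ltey g : (norm2 mu g < +oo) = (energy g < +oo).
Proof.
rewrite norm2E; apply/idP/idP; last exact: poweR_lty.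
by apply: lty_poweRy; rewrite invr_neq0.
Qed.

Lemma energyD_le g h : cmeasurable g -> cmeasurable h ->
  energy (fun z => g z + h z)%R <= 2%:E * (energy g + energy h).
Proof.
move=> mg mh; rewrite /energy -ge0_integralD//; last 4 first.
- by move=> z _; rewrite lee_fin sqmod_ge0.
- exact: measurable_sqmod.
- by move=> z _; rewrite lee_fin sqmod_ge0.
- exact: measurable_sqmod.
rewrite -ge0_integralZl_EFin//; last 2 first.
- by move=> z _; rewrite lee_fin addr_ge0 ?sqmod_ge0.
- by apply: emeasurable_funD; exact: measurable_sqmod.
apply: ge0_le_integral => //.
- by move=> z _; rewrite lee_fin sqmod_ge0.
- exact/measurable_sqmod/cmeasurableD.
- by apply: measurable_funeM; apply: emeasurable_funD; exact: measurable_sqmod.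
- by move=> z _; rewrite -EFinD -EFinM lee_fin sqmodD_le.
Qed.

Lemma energyM_le (u g : circle R -> R[i]) (C : R) : cmeasurable u ->
  cmeasurable g -> (0 <= C)%R -> (forall z, sqmod (u z) <= C)%R ->
  energy (fun z => u z * g z)%R <= C%:E * energy g.
Proof.
move=> mu' mg C0 uC; rewrite /energy -ge0_integralZl_EFin//; last 2 first.
- by move=> z _; rewrite lee_fin sqmod_ge0.
- exact: measurable_sqmod.
apply: ge0_le_integral => //.
- by move=> z _; rewrite lee_fin sqmod_ge0.
- exact/measurable_sqmod/cmeasurableM.
- by apply: measurable_funeM; exact: measurable_sqmod.
- by move=> z _; rewrite -EFinM lee_fin sqmodM ler_wpM2r ?sqmod_ge0.
Qed.

Lemma energyMX n g :
  energy (fun z : circle R => (z : R[i]) ^+ n * g z)%R = energy g.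
Proof.
by apply: eq_integral => z _; rewrite sqmodM sqmod_circleX mul1r.
Qed.

Lemma energy_bounded g (C : R) : cmeasurable g -> (0 <= C)%R ->
  (forall z, sqmod (g z) <= C)%R -> energy g < +oo.
Proof.
move=> mg C0 gC; apply: (@le_lt_trans _ _ (\int[mu]_z (cst C%:E z))).
  apply: ge0_le_integral => //.
  - by move=> z _; rewrite lee_fin sqmod_ge0.
  - exact: measurable_sqmod.
  - by move=> z _; rewrite lee_fin.
by rewrite integral_cst// [X in _ * X](@probability_setT _ _ _ mu) mule1 ltey.
Qed.

Lemma energy_cvg0 (g_ : nat -> circle R -> R[i]) (G : circle R -> R) :
  (forall n, cmeasurable (g_ n)) -> measurable_fun setT G ->
  \int[mu]_z (G z)%:E < +oo ->
  (forall n z, (sqmod (g_ n z) <= G z)%R) ->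
  (forall z, sqmod (g_ n z) @[n --> \oo] --> (0 : R)%R) ->
  energy (g_ n) @[n --> \oo] --> 0.
Proof.
move=> mg mG iG gG g0.
rewrite (_ : nbhs 0 = nbhs (\int[mu]_(z in setT) (cst 0 z))); last by rewrite integral0.
have G0 z : (0 <= G z)%R by rewrite (le_trans _ (gG 0%N z))// sqmod_ge0.
apply: (@dominated_cvg _ _ _ mu _ measurableT
  (fun n z => (sqmod (g_ n z))%:E) (cst 0) (EFin \o G)) => //.
- by move=> n; exact: measurable_sqmod.
- by move=> z _; apply: cvg_EFin; [exact: nearW|exact: g0].
- apply/integrableP; split; first exact/measurable_EFinP.
  by under eq_integral do rewrite /= ger0_norm ?G0//.
- by move=> n z _ /=; rewrite lee_fin ger0_norm ?sqmod_ge0.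
Qed.

End L2_closure.

Section step_polynomials.
Context {R : realType}.
Implicit Types t u y d : R.

Lemma exprn_harmonic_le t n : 0 <= t -> t <= 1 -> t ^+ n * (1 + n%:R * (1 - t)) <= 1.
Proof.
move=> t0 t1; elim: n => [|n IHn]; first by rewrite expr0 mul0r addr0 mulr1.
apply: le_trans IHn; rewrite exprSr -mulrA ler_wpM2l ?exprn_ge0// -natr1.
have : 0 <= n%:R :> R by [].
move: (n%:R) => m m0; have := mulr_ge0 m0 (sqr_ge0 (1 - t)).
have := sqr_ge0 (1 - t); nra.
Qed.

Lemma bernoulli_le u n : 0 <= u -> u <= 1 -> 1 - n%:R * u <= (1 - u) ^+ n.
Proof.
move=> u0 u1; elim: n => [|n IHn]; first by rewrite expr0 mul0r subr0.
have u1' : 0 <= 1 - u by rewrite subr_ge0.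
rewrite exprS; apply: le_trans (ler_wpM2l u1' IHn).
rewrite -natr1; have : 0 <= n%:R :> R by [].
move: (n%:R) => m m0; have := mulr_ge0 m0 (sqr_ge0 u); nra.
Qed.

Lemma harmonic_cvg0 (a : nat -> R) d : 0 < d -> (forall n, 0 <= a n) ->
  (forall n, a n * (n%:R * d) <= 1) -> a n @[n --> \oo] --> (0 : R).
Proof.
move=> d0 a0 ad; apply/cvgrPdist_lt => e e0; near=> n.
have n0 : 0 < n%:R * d by rewrite mulr_gt0// ltr0n; near: n; exists 1%N.
rewrite sub0r normrN ger0_norm//.
have : (e * d)^-1 < n%:R.
  by near: n; exact: nbhs_infty_gtr.
rewrite invf_plt ?posrE ?mulr_gt0//; last by move: n0; rewrite pmulr_lgt0.
move=> ned; have := ad n; rewrite -ler_pdivlMr// div1r => /le_lt_trans; apply.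
have n1 : 0 < n%:R :> R by move: n0; rewrite pmulr_lgt0.
by rewrite invfM ltr_pdivrMr.
Unshelve. all: by end_near. Qed.

(* With exponent 4 ^ n the limit at y = 1/2 would be 1/e; the factor n makes it 0,
   so that the limit is an indicator function. *)
Definition steppoly n y : R := (1 - y ^+ (2 * n)) ^+ (n * 4 ^ n).

Lemma steppoly_itv n y : 0 <= y -> y <= 1 -> 0 <= steppoly n y <= 1.
Proof.
move=> y0 y1; have u0 : 0 <= 1 - y ^+ (2 * n) by rewrite subr_ge0 exprn_ile1.
by rewrite /steppoly exprn_ge0//= exprn_ile1// gerBl exprn_ge0.
Qed.

Lemma steppoly_cvg y : 0 <= y -> y <= 1 ->
  steppoly n y @[n --> \oo] --> ((y < 2^-1)%R%:R : R).
Proof.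
move=> y0 y1; have un n : 0 <= y ^+ (2 * n) <= 1 by rewrite exprn_ge0//= exprn_ile1.
have [y2|y2] := ltP y 2^-1; last first.
  apply: (@harmonic_cvg0 _ 1) => // n; first by case/andP: (steppoly_itv n y0 y1).
  have /andP[u0 u1] := un n.
  have := @exprn_harmonic_le (1 - y ^+ (2 * n)) (n * 4 ^ n).
  rewrite subr_ge0 gerBl u0 u1 => /(_ isT isT); apply: le_trans.
  rewrite ler_wpM2l//; first by rewrite exprn_ge0// subr_ge0.
  rewrite mulr1 opprB addrCA subrr addr0 natrM natrX -mulrA ler_wpDl//.
  rewrite ler_peMr// exprM -exprMn exprn_ege1//.
  by move: y2; rewrite expr2; nra.
set c := (1 - 2 * y); have c0 : 0 < c by rewrite /c; lra.
apply/cvgrPdist_lt => e e0.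
have : 1 - steppoly n y @[n --> \oo] --> (0 : R).
  apply: (@harmonic_cvg0 _ (c ^+ 2)); first by rewrite exprn_gt0.
    by move=> n; rewrite subr_ge0; case/andP: (steppoly_itv n y0 y1).
  move=> n; have /andP[u0 u1] := un n.
  have := bernoulli_le (n * 4 ^ n) u0 u1; rewrite -/(steppoly n y) => qn.
  have tn := @exprn_harmonic_le (2 * y) n.
  have {}tn : ((2 * y) ^+ n) * (1 + n%:R * c) <= 1 by apply: tn; lra.
  have t0 : 0 <= (2 * y) ^+ n by rewrite exprn_ge0//; lra.
  have Kt : (n * 4 ^ n)%:R * y ^+ (2 * n) = n%:R * ((2 * y) ^+ n) ^+ 2.
    rewrite natrM natrX -mulrA; congr (_ * _).
    rewrite exprM -exprMn exprAC; congr (_ ^+ _); rewrite exprMn; congr (_ * _).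
    by rewrite expr2 -natrM.
  rewrite Kt in qn; move: qn tn t0.
  have : 0 <= n%:R :> R by [].
  move: (steppoly n y) (n%:R) ((2 * y) ^+ n) => q m t m0 qn tn t0.
  have q1 : 1 - q <= m * t ^+ 2 by lra.
  apply: le_trans (ler_wpM2r _ q1) _; first by rewrite mulr_ge0// sqr_ge0.
  have tm0 : 0 <= t * (m * c) by rewrite !mulr_ge0// ltW.
  have tm : t * (m * c) <= 1 by nra.
  have -> : m * t ^+ 2 * (m * c ^+ 2) = (t * (m * c)) ^+ 2 by ring.
  by rewrite exprn_ile1.
move/cvgrPdist_lt => /(_ e e0); apply: filterS => n.
by rewrite sub0r normrN.
Qed.

End step_polynomials.

Section polynomial_closure.
Context {R : realType}.
Variable mu : probability (circle R) R.
Implicit Types g h : circle R -> R[i].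
Local Notation "'En[ g ]" := (energy mu g%R) (at level 0).


Definition polyL2 g := cmeasurable g /\ forall e : R, 0 < e ->
  exists p : {poly R[i]}, ('En[fun z => g z - p.[z : R[i]]] < e%:E)%E.

Lemma energy_eq g h : g =1 h -> 'En[g] = 'En[h].
Proof. by move=> /funext ->. Qed.

Lemma energy_horner (p : {poly R[i]}) :
  ('En[fun z : circle R => p.[z : R[i]]] < +oo)%E.
Proof.
have [C pC] := sqmod_horner_bounded p.
have C0 : 0 <= C by apply: le_trans (pC point); exact: sqmod_ge0.
exact: energy_bounded (cmeasurable_horner p) C0 pC.
Qed.

Lemma polyL2_energy g : polyL2 g -> ('En[g] < +oo)%E.
Proof.
move=> [mg /(_ 1 ltr01)[p gp]].
rewrite (@energy_eq _ (fun z => (g z - p.[z : R[i]]) + p.[z : R[i]])); last first.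
  by move=> z; rewrite subrK.
have mp := cmeasurable_horner p.
apply: le_lt_trans (energyD_le _ (cmeasurableB mg mp) mp) _.
by rewrite lte_mul_pinfty// lte_add_pinfty ?energy_horner// (lt_trans gp)// ltey.
Qed.

Lemma polyL2_closed g : cmeasurable g ->
  (forall e : R, 0 < e -> exists2 h, polyL2 h &
     ('En[fun z => g z - h z] < e%:E)%E) -> polyL2 g.
Proof.
move=> mg gh; split => // e e0.
have e4 : 0 < e / 4 by lra.
have [h [mh /(_ _ e4)[p hp]] {}gh] := gh _ e4; exists p.
rewrite (@energy_eq _ (fun z => (g z - h z) + (h z - p.[z : R[i]]))); last first.
  by move=> z; rewrite addrA subrK.
apply: le_lt_trans (energyD_le _ _ _) _; [exact: cmeasurableB| |].
  by apply: cmeasurableB => //; exact: cmeasurable_horner.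
have -> : e%:E = (2%:E * ((e / 4)%:E + (e / 4)%:E))%E.
  by rewrite -EFinD -EFinM; congr EFin; lra.
by rewrite lte_pmul2l// lteD.
Qed.

Lemma polyL2_horner (p : {poly R[i]}) : polyL2 (fun z => p.[z : R[i]]).
Proof.
split=> [|e e0]; first exact: cmeasurable_horner.
exists p; apply: le_lt_trans (_ : 0 < _)%E; last by rewrite lte_fin.
rewrite /energy integral0_eq// => z _.
by rewrite subrr /sqmod /= expr0n addr0.
Qed.

Lemma polyL2_cst c : polyL2 (fun=> c).
Proof.
by rewrite (_ : (fun _ => _) = (fun z : circle R => c%:P.[z : R[i]]));
  [exact: polyL2_horner|apply/funext => z; rewrite hornerC].
Qed.

Lemma polyL2D g h : polyL2 g -> polyL2 h -> polyL2 (fun z => g z + h z).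
Proof.
move=> [mg gp] [mh hp]; split=> [|e e0]; first exact: cmeasurableD.
have e4 : 0 < e / 4 by lra.
have [[p {}gp] [q {}hp]] := (gp _ e4, hp _ e4); exists (p + q).
rewrite (@energy_eq _ (fun z => (g z - p.[z : R[i]]) + (h z - q.[z : R[i]]))); last first.
  by move=> z; rewrite hornerD opprD addrACA.
apply: le_lt_trans (energyD_le _ _ _) _.
- by apply: cmeasurableB => //; exact: cmeasurable_horner.
- by apply: cmeasurableB => //; exact: cmeasurable_horner.
have -> : e%:E = (2%:E * ((e / 4)%:E + (e / 4)%:E))%E.
  by rewrite -EFinD -EFinM; congr EFin; lra.
by rewrite lte_pmul2l// lteD.
Qed.

(* Bounded multiplication is continuous, so stability need only be checked on
   polynomials. *)
Lemma polyL2_mul (u : circle R -> R[i]) (C : R) : cmeasurable u ->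
  (forall z, sqmod (u z) <= C) ->
  (forall p : {poly R[i]}, polyL2 (fun z => u z * p.[z : R[i]])) ->
  forall g, polyL2 g -> polyL2 (fun z => u z * g z).
Proof.
move=> mu' uC up g [mg gp].
have C0 : 0 <= C by apply: le_trans (uC point); exact: sqmod_ge0.
apply: polyL2_closed => [|e e0]; first exact: cmeasurableM.
have eC : 0 < e / (C + 1) by rewrite divr_gt0//; lra.
have [p {}gp] := gp _ eC; exists (fun z => u z * p.[z : R[i]]) => //.
rewrite (@energy_eq _ (fun z => u z * (g z - p.[z : R[i]]))); last first.
  by move=> z; rewrite mulrBr.
have mgp : cmeasurable (fun z => g z - p.[z : R[i]]).
  by apply: cmeasurableB => //; exact: cmeasurable_horner.
apply: (@le_lt_trans _ _ ((C + 1)%:E * 'En[fun z => g z - p.[z : R[i]]])%E).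
  by apply: energyM_le => //; [lra|move=> z; rewrite (le_trans (uC z))//; lra].
rewrite muleC -lte_pdivlMr// ?divr_gt0//; lra.
Qed.

End polynomial_closure.

Section multipliers.
Context {R : realType}.
Variable mu : probability (circle R) R.
Implicit Types (g : circle R -> R[i]) (u v : circle R -> R[i]).
Implicit Types A B : set (circle R).

Definition multiplier u := [/\ cmeasurable u,
  exists C : R, forall z, sqmod (u z) <= C &
  forall g, polyL2 mu g -> polyL2 mu (fun z => u z * g z)].

Lemma multiplier_cst c : multiplier (fun=> c).
Proof.
split; [exact: cmeasurable_cst|by exists (sqmod c)|].
apply: (polyL2_mul (C := sqmod c)) => //.
move=> p; rewrite (_ : (fun _ => _) = (fun z : circle R => (c *: p).[z : R[i]])).
  exact: polyL2_horner.
by apply/funext => z; rewrite hornerZ.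
Qed.

Lemma multiplierD u v : multiplier u -> multiplier v ->
  multiplier (fun z => u z + v z).
Proof.
move=> [mu1 [C uC] u1] [mv [D vD] v1]; split; first exact: cmeasurableD.
  exists (2 * (C + D)) => z; apply: le_trans (sqmodD_le _ _) _.
  by rewrite ler_wpM2l// lerD.
move=> g gp; under eq_fun do rewrite mulrDl.
by apply: polyL2D; [exact: u1|exact: v1].
Qed.

Lemma multiplierM u v : multiplier u -> multiplier v ->
  multiplier (fun z => u z * v z).
Proof.
move=> [mu1 [C uC] u1] [mv [D vD] v1]; split; first exact: cmeasurableM.
  by exists (C * D) => z; rewrite sqmodM ler_pM// sqmod_ge0.
move=> g gp; under eq_fun do rewrite -mulrA.
by apply: u1; exact: v1.
Qed.

Lemma multiplierX u n : multiplier u -> multiplier (fun z => u z ^+ n).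
Proof.
move=> um; elim: n => [|n IHn].
  by under eq_fun do rewrite expr0; exact: multiplier_cst.
by under eq_fun do rewrite exprS; exact: multiplierM.
Qed.

Lemma multiplier_onem u : multiplier u -> multiplier (fun z => 1 - u z).
Proof.
move=> um; rewrite (_ : (fun _ => _) = (fun z => 1 + (-1) * u z)).
  by apply: multiplierD (multiplierM _ um); exact: multiplier_cst.
by apply/funext => z; rewrite mulN1r.
Qed.

Lemma multiplier_circle_val : multiplier (@circle_val R).
Proof.
split; [exact: cmeasurable_circle_val|by exists 1 => z; rewrite sqmod_circle|].
apply: (polyL2_mul (C := 1)); first exact: cmeasurable_circle_val.
  by move=> z; rewrite sqmod_circle.
move=> p; rewrite (_ : (fun _ => _) = (fun z : circle R => (p * 'X).[z : R[i]])).
  exact: polyL2_horner.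
by apply/funext => z; rewrite hornerMX mulrC.
Qed.

Hypothesis polyL2V : polyL2 mu (fun z : circle R => (z : R[i])^-1).

Lemma multiplierV : multiplier (fun z : circle R => (z : R[i])^-1).
Proof.
have sq1 (z : circle R) : sqmod (z : R[i])^-1 = 1.
  apply: (@mulfI _ (sqmod (z : R[i]))); first by rewrite sqmod_circle oner_neq0.
  rewrite -sqmodM mulfV ?circle_neq0// sqmod_circle mulr1.
  by rewrite /sqmod /= expr1n expr0n addr0.
split; [exact: cmeasurableV|by exists 1 => z; rewrite sq1|].
apply: (polyL2_mul (C := 1)); [exact: cmeasurableV|by move=> z; rewrite sq1|].
elim/poly_ind => [|p c _].
  by under eq_fun do rewrite horner0 mulr0; exact: polyL2_cst.
rewrite (_ : (fun _ => _) = (fun z : circle R => p.[z : R[i]] + c * (z : R[i])^-1)).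
  apply: polyL2D; first exact: polyL2_horner.
  by have [_ _] := multiplier_cst c; apply.
apply/funext => z; rewrite hornerMXaddC mulrDr [_ * c]mulrC; congr (_ + _).
by rewrite mulrC mulfK// circle_neq0.
Qed.

Lemma multiplier_Re : multiplier (fun z : circle R => (complex.Re (z : R[i]))%:C%C).
Proof.
rewrite (_ : (fun _ => _) = (fun z : circle R => 2^-1 * ((z : R[i]) + (z : R[i])^-1))).
  apply: multiplierM; first exact: multiplier_cst.
  exact: multiplierD multiplier_circle_val multiplierV.
apply/funext => z; rewrite circleV; case: (circle_val z) => a b /=.
apply: (@mulfI _ 2); first by rewrite pnatr_eq0.
rewrite mulrA mulfV ?pnatr_eq0// mul1r mulr_natl mulr2n.
by apply/eqP; rewrite eq_complex /= subrr addr0 !eqxx.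
Qed.

Lemma multiplier_Im : multiplier (fun z : circle R => (complex.Im (z : R[i]))%:C%C).
Proof.
rewrite (_ : (fun _ => _) = (fun z : circle R =>
    (2 * 'i%C)^-1 * ((z : R[i]) + (-1) * (z : R[i])^-1))).
  apply: multiplierM; first exact: multiplier_cst.
  apply: multiplierD; first exact: multiplier_circle_val.
  by apply: multiplierM; [exact: multiplier_cst|exact: multiplierV].
apply/funext => z; rewrite circleV; case: (circle_val z) => a b /=.
have i0 : 2 * 'i%C != 0 :> R[i].
  by rewrite mulf_neq0 ?pnatr_eq0// eq_complex /= oner_eq0 andbF.
apply: (mulfI i0); rewrite mulrA mulfV// mul1r mulN1r -mulrA mulr_natl mulr2n.
by apply/eqP; rewrite eq_complex /=; apply/andP; split; apply/eqP; ring.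
Qed.

Lemma multiplier_indic_lim A (U : nat -> circle R -> R) : measurable A ->
  (forall n, multiplier (fun z => (U n z)%:C%C)) ->
  (forall n z, 0 <= U n z <= 1) ->
  (forall z, U n z @[n --> \oo] --> (\1_A z : R)) ->
  multiplier (fun z => (\1_A z)%:C%C).
Proof.
move=> mA Um U01 UA.
have mI : cmeasurable (fun z => (\1_A z : R)%:C%C).
  by apply: cmeasurable_real; exact: measurable_indic.
have I01 z : 0 <= (\1_A z : R) <= 1.
  by rewrite indicE; case: (_ \in _); rewrite ?lexx ler01.
split => //.
  exists 1 => z; rewrite sqmod_real; have /andP[? ?] := I01 z.
  exact: exprn_ile1.
move=> g pg; have [mg _] := pg; apply: polyL2_closed => [|e e0].
  exact: cmeasurableM.
have ms n : cmeasurable (fun z => ((\1_A z)%:C%C - (U n z)%:C%C) * g z).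
  by apply: cmeasurableM => //; apply: cmeasurableB => //; case: (Um n).
have /fine_cvgP : energy mu (fun z => ((\1_A z)%:C%C - (U n z)%:C%C) * g z)
    @[n --> \oo] --> 0%E.
  apply: (energy_cvg0 (G := fun z => sqmod (g z))) => //.
  - exact/measurable_EFinP/measurable_sqmod.
  - exact: polyL2_energy pg.
  - move=> n z; rewrite sqmodM ler_piMl ?sqmod_ge0//.
    rewrite -rmorphB sqmod_real.
    have /andP[? ?] := I01 z; have /andP[? ?] := U01 n z.
    rewrite -real_normK ?num_real// exprn_ile1// ler_norml; lra.
  - move=> z; rewrite -[X in _ --> X](mul0r (sqmod (g z))).
    under eq_fun do rewrite sqmodM -rmorphB sqmod_real.
    apply: cvgMl; rewrite -[X in _ --> X](expr0n R 2).
    apply: (@cvg_comp _ _ _ (fun n => \1_A z - U n z) (fun x => x ^+ 2) _ (nbhs 0)).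
      by rewrite -(subrr (\1_A z : R)); apply: cvgB; [exact: cvg_cst|exact: UA].
    exact: exprn_continuous.
move=> [fnr]; move/cvgrPdist_lt => /(_ _ e0) H.
have [N _ /(_ N (leqnn N))[fN]] := filterI fnr H.
rewrite /= sub0r normrN ger0_norm ?fine_ge0 ?energy_ge0// => NE.
exists (fun z => (U N z)%:C%C * g z); first by have [_ _] := Um N; apply.
under eq_fun do rewrite -mulrBl.
by rewrite -(fineK fN) lte_fin.
Qed.

Definition multiplier_set A := measurable A /\ multiplier (fun z => (\1_A z)%:C%C).

Lemma multiplier_setC A : multiplier_set A -> multiplier_set (~` A).
Proof.
move=> [mA Am]; split; first exact: measurableC.
rewrite (_ : (fun _ => _) = (fun z => 1 - (\1_A z)%:C%C)).
  exact: multiplier_onem.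
apply/funext => z; rewrite !indicE in_setC; case: (z \in A) => /=.
  by rewrite subrr.
by rewrite subr0.
Qed.

Lemma multiplier_setI A B : multiplier_set A -> multiplier_set B ->
  multiplier_set (A `&` B).
Proof.
move=> [mA Am] [mB Bm]; split; first exact: measurableI.
rewrite (_ : (fun _ => _) = (fun z => (\1_A z)%:C%C * (\1_B z)%:C%C)).
  exact: multiplierM.
by apply/funext => z; rewrite indicI rmorphM.
Qed.

Lemma multiplier_set0 : multiplier_set set0.
Proof.
split => //; rewrite (_ : (fun _ => _) = (fun=> 0)); first exact: multiplier_cst.
by apply/funext => z; rewrite indic0.
Qed.

Lemma multiplier_setU A B : multiplier_set A -> multiplier_set B ->
  multiplier_set (A `|` B).
Proof.
move=> Am Bm; rewrite -[A `|` B]setCK setCU.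
by apply: multiplier_setC; apply: multiplier_setI; exact: multiplier_setC.
Qed.

Lemma multiplier_bigcup (F : nat -> set (circle R)) :
  (forall n, multiplier_set (F n)) -> multiplier_set (\bigcup_n F n).
Proof.
move=> Fm.
have Gm n : multiplier_set (\big[setU/set0]_(i < n) F i).
  elim: n => [|n IHn]; first by rewrite big_ord0; exact: multiplier_set0.
  by rewrite big_ord_recr; exact: multiplier_setU.
have mF : measurable (\bigcup_n F n).
  by apply: bigcupT_measurable => n; case: (Fm n).
split => //.
apply: (multiplier_indic_lim (U := fun n => \1_(\big[setU/set0]_(i < n) F i))) => //.
- by move=> n; case: (Gm n).
- by move=> n z; rewrite indicE; case: (_ \in _); rewrite ?lexx ler01.
- move=> z; have [[k _ Fkz]|Fz] := pselect ((\bigcup_n F n) z).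
    apply: (@cvg_near_cst); exists k.+1 => // n /= kn.
    rewrite !indicE !mem_set//; first by exists k.
    by rewrite -bigcup_mkord; exists k.
  rewrite (_ : (fun _ => _) = (fun=> \1_(\bigcup_n F n) z)); first exact: cvg_cst.
  apply/funext => n; rewrite !indicE !memNset// -bigcup_mkord => -[k _ Fkz].
  by apply: Fz; exists k.
Qed.

Lemma multiplier_ray (Y : circle R -> R) (a : R) :
  multiplier (fun z => (Y z)%:C%C) -> (forall z, -1 <= Y z <= 1) ->
  multiplier_set [set z | Y z < a].
Proof.
move=> Ym Y1.
have mY : measurable_fun setT Y by case: Ym => -[].
have mA : measurable [set z | Y z < a].
  have := mY measurableT `]-oo, a[%classic (measurable_itv _).
  by rewrite setTI set_itvNyo.
split => //.
pose b := 2 * (1 + `|a|); have b0 : 0 < b by rewrite mulr_gt0// ltr_pwDl.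
pose y z := 2^-1 + (Y z - a) / b.
have y01 z : 0 <= y z <= 1.
  have /andP[Y0 Y1'] := Y1 z; have := ler_norm a; have := ler_norm (- a).
  rewrite normrN => aN aP.
  have : - 2^-1 <= (Y z - a) / b <= 2^-1.
    by rewrite ler_pdivlMr// ler_pdivrMr// /b; apply/andP; split; lra.
  by rewrite /y => /andP[? ?]; apply/andP; split; lra.
have yE z : (y z < 2^-1) = (Y z < a).
  by rewrite /y gtrDl pmulr_llt0 ?invr_gt0// subr_lt0.
apply: (multiplier_indic_lim (U := fun n z => steppoly n (y z))) => //.
- move=> n; rewrite (_ : (fun _ => _) = (fun z =>
      (1 - ((2^-1 - a / b)%:C%C + (b^-1)%:C%C * (Y z)%:C%C) ^+ (2 * n)) ^+ (n * 4 ^ n))).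
    apply: multiplierX; apply: multiplier_onem; apply: multiplierX.
    apply: multiplierD; first exact: multiplier_cst.
    by apply: multiplierM => //; exact: multiplier_cst.
  apply/funext => z; rewrite /steppoly.
  have -> : (2^-1 - a / b)%:C%C + (b^-1)%:C%C * (Y z)%:C%C = (y z)%:C%C.
    by rewrite -rmorphM -rmorphD /y mulrBl addrA [b^-1 * _]mulrC [in LHS]addrAC.
  by rewrite rmorphXn rmorphB rmorph1 rmorphXn.
- by move=> n z; apply: steppoly_itv; case/andP: (y01 z).
- move=> z; have /andP[y0 y1] := y01 z; have := steppoly_cvg y0 y1.
  rewrite yE indicE (_ : (z \in _) = (Y z < a)) //.
  by apply/idP/idP; rewrite inE.
Qed.

Lemma circle_Re_Im_itv (z : circle R) :
  (-1 <= complex.Re (z : R[i]) <= 1) /\ (-1 <= complex.Im (z : R[i]) <= 1).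
Proof.
have := sqmod_circle z; rewrite /sqmod; case: (circle_val z) => a b /= ab.
by split; apply/andP; split; nra.
Qed.

Lemma multiplier_measurable A : measurable A -> multiplier_set A.
Proof.
have ray (Y : circle R -> R) (D : set R) : multiplier (fun z => (Y z)%:C%C) ->
    (forall z, -1 <= Y z <= 1) -> measurable D -> multiplier_set (Y @^-1` D).
  move=> Ym Y1; rewrite [measurable]RGenInftyO.measurableE.
  move: D; apply: (@smallest_sub _ _ _ [set D | multiplier_set (Y @^-1` D)]).
    split => [|D' /= Dm|F /= Fm]; first by rewrite /= preimage_set0; exact: multiplier_set0.
      by rewrite setTD preimage_setC; exact: multiplier_setC.
    by rewrite preimage_bigcup; exact: multiplier_bigcup.
  move=> _ [a ->] /=; rewrite (_ : _ @^-1` _ = [set z | Y z < a]).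
    exact: multiplier_ray.
  by rewrite set_itvNyo.
move=> [D mD <-]; rewrite setTI.
move: D mD; apply: (@smallest_sub _ _ _
    [set D : set (R * R) | multiplier_set (reim @^-1` D)]).
  split => [|D' /= Dm|F /= Fm]; first by rewrite /= preimage_set0; exact: multiplier_set0.
    by rewrite setTD preimage_setC; exact: multiplier_setC.
  by rewrite preimage_bigcup; exact: multiplier_bigcup.
move=> _ [[D mD <-]|[D mD <-]] /=; rewrite setTI.
  by apply: (ray _ _ multiplier_Re) => // z; case: (circle_Re_Im_itv z).
by apply: (ray _ _ multiplier_Im) => // z; case: (circle_Re_Im_itv z).
Qed.

End multipliers.

Section polynomial_density.
Context {R : realType}.
Variable mu : probability (circle R) R.
Hypothesis polyL2V : polyL2 mu (fun z : circle R => (z : R[i])^-1).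

Import HBSimple HBNNSimple.

Lemma polyL2_real (r : circle R -> R) : measurable_fun setT r ->
  (energy mu (fun z => (r z)%:C%C) < +oo)%E -> (forall z, 0 <= r z) ->
  polyL2 mu (fun z => (r z)%:C%C).
Proof.
move=> mr er r0; have mer : measurable_fun setT (EFin \o r) by exact/measurable_EFinP.
pose s := nnsfun_approx measurableT mer.
have sW n : polyL2 mu (fun z => (s n z)%:C%C).
  rewrite (_ : (fun _ => _) = (fun z => \sum_(y <- finmap.enum_fset (fset_set (range (s n))))
    y%:C%C * (\1_(s n @^-1` [set y]) z)%:C%C)); last first.
    apply/funext => z; rewrite fimfunE fsbig_finite//= rmorph_sum.
    by apply: eq_bigr => y _; rewrite rmorphM.
  elim: (finmap.enum_fset _) => [|y t IHt].
    by under eq_fun do rewrite big_nil; exact: polyL2_cst.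
  under eq_fun do rewrite big_cons; apply: polyL2D => //.
  have [_ [_ _ sm]] : multiplier_set mu (s n @^-1` [set y]).
    by apply: (multiplier_measurable polyL2V); exact: measurable_sfunP.
  have [_ _ ] := multiplier_cst mu y%:C%C; apply.
  by under eq_fun do rewrite -[_%:C%C]mulr1; apply: sm; exact: polyL2_cst.
have srle n z : 0 <= s n z <= r z.
  rewrite fun_ge0/=; have := @le_approx _ _ _ setT (EFin \o r) n z.
  rewrite /s nnsfun_approxE lee_fin; apply => // x _.
  by rewrite lee_fin.
apply: polyL2_closed => [|e e0]; first exact: cmeasurable_real.
have /fine_cvgP : energy mu (fun z => (r z)%:C%C - (s n z)%:C%C) @[n --> \oo] --> 0%E.
  apply: (energy_cvg0 (G := fun z => sqmod (r z)%:C%C)) => //.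
  - move=> n; apply: cmeasurableB; last by case: (sW n).
    exact: cmeasurable_real.
  - exact/measurable_EFinP/measurable_sqmod/cmeasurable_real.
  - move=> n z; rewrite -rmorphB !sqmod_real.
    by have /andP[? ?] := srle n z; rewrite ler_sqr ?nnegrE ?subr_ge0// gerBl.
  - move=> z; rewrite -[X in _ --> X](expr0n R 2).
    under eq_fun do rewrite -rmorphB sqmod_real.
    apply: (@cvg_comp _ _ _ (fun n => r z - s n z) (fun x => x ^+ 2) _ (nbhs 0)).
      rewrite -(subrr (r z)); apply: cvgB; first exact: cvg_cst.
      have : EFin \o s^~ z @ \oo --> (EFin \o r) z.
        by apply: cvg_nnsfun_approx => // x _; rewrite lee_fin.
      by move/fine_cvg.
    exact: exprn_continuous.
move=> [fnr]; move/cvgrPdist_lt => /(_ _ e0) H.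
have [N _ /(_ N (leqnn N))[fN]] := filterI fnr H.
rewrite /= sub0r normrN ger0_norm ?fine_ge0 ?energy_ge0// => NE.
by exists (fun z => (s N z)%:C%C) => //; rewrite -(fineK fN) lte_fin.
Qed.


Lemma polyL2_memL2 g : memL2 mu g -> polyL2 mu g.
Proof.
move=> [m1 m2]; rewrite norm2_ltey => eg.
have part (r : circle R -> R) : measurable_fun setT r ->
    (forall z, r z ^+ 2 <= sqmod (g z)) -> polyL2 mu (fun z => (r z)%:C%C).
  move=> mr rg.
  have half (t : circle R -> R) : measurable_fun setT t -> (forall z, 0 <= t z) ->
      (forall z, t z <= `|r z|) -> polyL2 mu (fun z => (t z)%:C%C).
    move=> mt t0 tr; apply: polyL2_real => //; apply: le_lt_trans eg.
    apply: ge0_le_integral => //.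
    - by move=> z _; rewrite lee_fin sqmod_ge0.
    - exact/measurable_sqmod/cmeasurable_real.
    - exact: measurable_sqmod.
    - move=> z _; rewrite lee_fin sqmod_real (le_trans _ (rg z))//.
      by rewrite -[r z ^+ 2]real_normK ?num_real// ler_sqr ?nnegrE.
  rewrite (_ : (fun _ => _) = (fun z => (r^\+ z)%:C%C + (-1) * (r^\- z)%:C%C)).
    apply: polyL2D.
      apply: half => [|z|z]; first exact: measurable_funrpos.
        exact: funrpos_ge0.
      by rewrite /funrpos ge_max ler_norm normr_ge0.
    have [_ _] := multiplier_cst mu (-1); apply; apply: half => [|z|z].
    - exact: measurable_funrneg.
    - exact: funrneg_ge0.
    - by rewrite /funrneg ge_max normr_ge0 -normrN ler_norm.
  apply/funext => z; rewrite mulN1r -rmorphB; congr (_%:C%C).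
  by rewrite -[LHS](congr1 (fun h => h z) (funrposBneg r)).
rewrite (_ : g = (fun z => (complex.Re (g z))%:C%C + 'i%C * (complex.Im (g z))%:C%C)).
  apply: polyL2D; first by apply: part => // z; rewrite lerDl sqr_ge0.
  have [_ _] := multiplier_cst mu 'i%C; apply.
  by apply: part => // z; rewrite lerDr sqr_ge0.
by apply/funext => z; rewrite -complexE.
Qed.

End polynomial_density.

Section beta_approximation.
Context {R : realType}.
Variable mu : probability (circle R) R.
Local Notation "'En[ g ]" := (energy mu g%R) (at level 0).

Lemma beta_approximating_energy f : beta_approximating mu f ->
  forall e : R, 0 < e -> exists K, forall k, (K <= k)%N ->
    exists2 p : {poly R[i]}, (size p <= (f k).+1)%N &
      ('En[fun z => (z : R[i]) ^- k - p.[z : R[i]]] < e%:E)%E.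
Proof.
move=> [_ bf] e e0; have se0 : 0 < Num.sqrt e by rewrite sqrtr_gt0.
have : \forall k \near \oo, (beta mu k (f k) < (Num.sqrt e)%:E)%E.
  move/fine_cvgP: bf => [bfin /cvgrPdist_lt /(_ _ se0)].
  apply: filterS2 bfin => k bk; rewrite sub0r normrN /= -{2}(fineK bk) lte_fin.
  exact/le_lt_trans/ler_norm.
move=> [K _ HK]; exists K => k /HK /= /ereal_inf_lt[_ [p /= sp <-]].
by rewrite norm2_lt// sqr_sqrtr ?ltW//; exists p.
Qed.

(* z^-1 = z^(k-1) z^-k, so an approximation of z^-k for a single k suffices. *)
Lemma beta_approximating_polyL2V f : beta_approximating mu f ->
  polyL2 mu (fun z : circle R => (z : R[i])^-1).
Proof.
move=> /beta_approximating_energy bf; split => [|e e0]; first exact: cmeasurableV.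
have [K /(_ _ (leqnSn K))[p _ ep]] := bf _ e0; exists ('X^K * p).
rewrite (@energy_eq _ _ _ (fun z =>
    (z : R[i]) ^+ K * ((z : R[i]) ^- K.+1 - p.[z : R[i]]))).
  by rewrite energyMX.
move=> z; have zK : (z : R[i]) ^+ K != 0 by rewrite expf_neq0// circle_neq0.
by rewrite hornerM hornerXn mulrBr exprSr invfM mulVKf.
Qed.

Lemma E_horner (Lam : set nat) (h : circle R -> R[i]) : E Lam h ->
  exists p : {poly R[i]}, h = (fun z => p.[z : R[i]]).
Proof.
move=> [s [c [_ ->]]]; exists (\sum_(n <- s) c n *: 'X^n).
apply/funext => z; rewrite horner_sum; apply: eq_bigr => n _.
by rewrite hornerZ hornerXn.
Qed.

Lemma E_Lambda_mulX (k l : nat -> nat) j (q : {poly R[i]}) : (0 < j)%N ->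
  (size q <= (l j).+1)%N ->
  E (Lambda k l) (fun z : circle R => (z : R[i]) ^+ k j * q.[z : R[i]]).
Proof.
move=> j0 sq; exists (iota (k j) (size q)), (fun n => q`_(n - k j)); split.
  move=> n; rewrite mem_iota => /andP[kn nk]; exists j; split => //.
  by rewrite -ltnS -addnS (leq_trans nk)// leq_add2l.
apply/funext => z; rewrite -{2}[k j]addn0 iotaDl big_map horner_coef mulr_sumr.
rewrite -(big_mkord xpredT (fun i =>
  (z : R[i]) ^+ k j * (q`_i * (z : R[i]) ^+ i))) /index_iota subn0.
by apply: eq_bigr => i _; rewrite addKn exprD mulrCA.
Qed.

Lemma E_Lambda_approx (f k l : nat -> nat) (hf : beta_approximating mu f)
    (hk : increasing_posnat k)
    (hl : ((l j)%:R - (f (k j))%:R : R) @[j --> \oo] --> +oo)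
    (p : {poly R[i]}) (e : R) : 0 < e ->
  exists2 h, E (Lambda k l) h & ('En[fun z => p.[z : R[i]] - h z] < e%:E)%E.
Proof.
move=> e0; have [C pC] := sqmod_horner_bounded p.
have C0 : 0 <= C by apply: le_trans (pC point); exact: sqmod_ge0.
have eC : 0 < e / (C + 1) by rewrite divr_gt0//; lra.
have [K bK] := beta_approximating_energy hf eC.
have [J _ lJ] := proj1 (cvgryPge _) hl (size p)%:R.
pose j := (maxn J K).+1.
have kge i : (i <= k i)%N.
  case: hk => kpos kinc; elim: i => // -[_|i IHi]; first exact: kpos.
  by apply: leq_ltn_trans IHi _; exact: kinc.
have Kk : (K <= k j)%N.
  by apply: leq_trans (kge j); rewrite ltnW// ltnS leq_maxr.
have lj : (f (k j) + size p <= l j)%N.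
  have /lJ /= : (J <= j)%N by rewrite ltnW// ltnS leq_maxl.
  by rewrite lerBrDr -natrD ler_nat addnC.
have [q sq qK] := bK _ Kk.
exists (fun z : circle R => (z : R[i]) ^+ k j * (q * p).[z : R[i]]).
  apply: E_Lambda_mulX => //; rewrite (leq_trans (size_polyMleq _ _))//.
  by rewrite -subn1 leq_subLR (leq_trans (leq_add sq (leqnn _)))// addSn add1n ltnS ltnW.
rewrite (@energy_eq _ _ _ (fun z : circle R => p.[z : R[i]] *
    ((z : R[i]) ^+ k j * ((z : R[i]) ^- k j - q.[z : R[i]])))); last first.
  move=> z; rewrite hornerM mulrBr mulfV ?expf_neq0 ?circle_neq0//.
  by rewrite mulrBr mulr1 mulrA [X in _ - X = _]mulrC.
have mV : cmeasurable (fun z : circle R => (z : R[i]) ^- k j - q.[z : R[i]]).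
  apply: cmeasurableB; last exact: cmeasurable_horner.
  by under eq_fun do rewrite -exprVn; exact/cmeasurableX/cmeasurableV.
have mXV : cmeasurable (fun z : circle R =>
    (z : R[i]) ^+ k j * ((z : R[i]) ^- k j - q.[z : R[i]])).
  by apply: cmeasurableM => //; exact/cmeasurableX/cmeasurable_circle_val.
apply: le_lt_trans (energyM_le (C := C + 1) _ _ mXV _ _) _.
- exact: cmeasurable_horner.
- lra.
- by move=> z; rewrite (le_trans (pC z))//; lra.
by rewrite energyMX muleC -lte_pdivlMr//; lra.
Qed.

End beta_approximation.

(* World: MathComp / MathComp-Analysis. The sequences k and l are indexed by
   {1, 2, ...}. *)
Theorem theorem3p3 (R : realType) (mu : probability (circle R) R)
    (hmu : Szc mu) (f : nat -> nat) (hf : beta_approximating mu f)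
    (k l : nat -> nat) (hk : increasing_posnat k)
    (hl : ((l j)%:R - (f (k j))%:R : R) @[j --> \oo] --> +oo) :
  dense_in_L2 mu (E (Lambda k l)).
Proof.
split=> [h /E_horner[p ->]|g gL2 e e0].
  have [m1 m2] := cmeasurable_horner p.
  by split => //; rewrite norm2_ltey; exact: energy_horner.
have e4 : 0 < e ^+ 2 / 4 by rewrite divr_gt0// exprn_gt0.
have [mg /(_ _ e4)[p gp]] := polyL2_memL2 (beta_approximating_polyL2V hf) gL2.
have [h Eh ph] := E_Lambda_approx hf hk hl p e4; exists h => //.
have mh : cmeasurable h.
  by have [q ->] := E_horner Eh; exact: cmeasurable_horner.
have mp := cmeasurable_horner p.
rewrite norm2_lt// (@energy_eq _ _ _ (fun z =>
    (g z - p.[z : R[i]]) + (p.[z : R[i]] - h z))); last first.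
  by move=> z; rewrite addrA subrK.
apply: le_lt_trans (energyD_le _ (cmeasurableB mg mp) (cmeasurableB mp mh)) _.
have -> : (e ^+ 2)%:E = (2%:E * ((e ^+ 2 / 4)%:E + (e ^+ 2 / 4)%:E))%E.
  by rewrite -EFinD -EFinM; congr EFin; lra.
by rewrite lte_pmul2l// lteD.
Qed.
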